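(* Suppose the iterated function system $\mathcal{S}=\{S_i\}_{i=1}^k$ of similarities on $\mathbb{R}$ has self-similar set $K=[0,1]$. The following are equivalent: (1) $\mathcal{S}$ satisfies the weak separation condition; (2) $\mathcal{S}$ satisfies the finite neighbour condition; (3) $\mathcal{S}$ satisfies the convex generalized finite type condition; (4) there exists some $c>0$ such that for any $0<\alpha\le 1$, words $\sigma,\tau\in\Lambda_\alpha$ and $z,w\in\{0,1\}$, either $S_\sigma(z)=S_\tau(w)$ or $|S_\sigma(z)-S_\tau(w)|\ge c\alpha$.
   Context: An iterated function system (IFS) $\mathcal{S}=\{S_i\}_{i=1}^k$ is a finite set of similarities $S_i(x)=r_ix+d_i:\mathbb{R}\to\mathbb{R}$ with $0<|r_i|<1$ and $k\ge 2$. Its self-similar set $K$ is the unique non-empty compact set with $K=\bigcup_{j=1}^k S_j(K)$. Words: $\Sigma=\{1,\dots,k\}$ and $\Sigma^*$ is the set of all finite words on $\Sigma$ (the empty word corresponds to the identity map, with ratio $1$). For $\sigma=(\sigma_1,\dots,\sigma_j)$ put $S_\sigma=S_{\sigma_1}\circ\cdots\circ S_{\sigma_j}$, $r_\sigma=\prod_{i=1}^j r_{\sigma_i}$ and (for $j\ge1$) $\sigma^-=(\sigma_1,\dots,\sigma_{j-1})$. For $\alpha>0$ let $\Lambda_\alpha=\{\sigma\in\Sigma^*: |r_\sigma|<\alpha\le |r_{\sigma^-}|\}$. Weak separation condition: there is some $x_0\in\mathbb{R}$ and an integer $N$ (or, equivalently, for all $x_0$ there is some $N$) such that for any $\alpha>0$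 and any finite word $\tau$, any closed ball of radius $\alpha$ contains no more than $N$ distinct points of the form $S_\sigma(S_\tau(x_0))$ with $\sigma\in\Lambda_\alpha$. Net intervals and neighbour sets: for $\alpha>0$ let $h_1<\dots<h_{s(\alpha)}$ be the distinct elements of $\{S_\sigma(0),S_\sigma(1):\sigma\in\Lambda_\alpha\}$ and $\mathcal{F}_\alpha=\{[h_j,h_{j+1}]:1\le j<s(\alpha),\ (h_j,h_{j+1})\cap K\ne\emptyset\}$ (net intervals of generation $\alpha$). For $\Delta\in\mathcal{F}_\alpha$, $T_\Delta(x)=rx+a$ is the unique such map with $r>0$ and $T_\Delta([0,1])=\Delta$. The neighbour set of $\Delta\in\mathcal{F}_\alpha$ is the set of maps $V_\alpha(\Delta)=\{T_\Delta^{-1}\circ S_\sigma:\sigma\in\Lambda_\alpha,\ S_\sigma([0,1])\supseteq\Delta\}$. Finite neighbour condition: the collection of all neighbour sets $\{V_\alpha(\Delta):\alpha>0,\ \Delta\in\mathcal{F}_\alpha\}$ is finite. Convex generalized finite type condition: for $V\subseteq\mathbb{R}$ let $\mathcal{E}_{\mathcal{S}}(V)=\bigcup_{\alpha>0}\{S_\sigma^{-1}\circ S_\tau:\sigma,\tau\in\Lambda_\alpha,\ S_\sigma(V)\cap S_\tau(V)\ne\emptyset\}$. A set $V$ is invariant if $S_j(V)\subseteq V$ for all $j$. $\mathcal{S}$ is of generalized finite type if $\mathcal{E}_{\mathcal{S}}(V)$ is finite for some non-empty bounded invariant open set $V$; it satisfies the convex generalized finite type condition if this holds with $V$ the interior of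 the convex hull of $K$ (here $V=(0,1)$). *)

(* Defs.v *)
From mathcomp Require Import all_boot all_order all_algebra.
From mathcomp Require Import all_classical all_reals all_analysis.

Set Implicit Arguments.
Unset Strict Implicit.
Unset Printing Implicit Defensive.

Import Order.TTheory GRing.Theory Num.Theory.
Import numFieldNormedType.Exports.

Local Open Scope classical_set_scope.
Local Open Scope card_scope.
Local Open Scope ring_scope.

Definition affine (R : realType) (r d : R) : R -> R := fun x => r * x + d.

(* The maps are indexed by 'I_k; they are not required to be pairwise
   distinct. *)
Record ifs (R : realType) (k : nat) := Ifs {
  ratio : 'I_k -> R ;
  shift : 'I_k -> R ;
  ifs_size_ge2 : (2 <= k)%N ;
  ifs_ratio_bound : forall i, 0 < `|ratio i| < 1 }.

Section IFS.
Variables (R : realType) (k : nat) (S : ifs R k).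
Implicit Types (w u v : seq 'I_k) (alpha a b : R) (K V : set R).

Definition sim (i : 'I_k) : R -> R := affine (ratio S i) (shift S i).

Definition self_similar_set K : Prop :=
  [/\ K !=set0, compact K & K = \bigcup_(i in [set: 'I_k]) (sim i @` K)].

Definition simw w : R -> R := foldr (fun i f => sim i \o f) idfun w.

Definition ratiow w : R := \prod_(i <- w) ratio S i.

Definition word_pred w := take (size w).-1 w.

(* The empty word has no predecessor, so it lies in no [Lambda alpha]. *)
Definition Lambda alpha : set (seq 'I_k) :=
  [set w | w <> [::] /\ `|ratiow w| < alpha <= `|ratiow (word_pred w)|].

Definition weak_separation : Prop :=
  exists (x0 : R) (N : nat), forall alpha, 0 < alpha ->
    forall u (c : R),
      closed_ball c alpha `&` [set simw w (simw u x0) | w in Lambda alpha]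
        #<= `I_N.

Definition endpoints alpha : set R :=
  [set simw w 0 | w in Lambda alpha] `|` [set simw w 1 | w in Lambda alpha].

(* [net_interval K alpha a b]: the interval [a, b] is a net interval of
   generation alpha, i.e. a and b are consecutive elements of
   [endpoints alpha] and ]a, b[ meets K. *)
Definition net_interval K alpha a b : Prop :=
  [/\ endpoints alpha a, endpoints alpha b, a < b,
      forall h, endpoints alpha h -> ~ (a < h < b)
    & `]a, b[ `&` K !=set0].

(* The increasing affine map sending [0, 1] onto [a, b]. *)
Definition net_map a b : R -> R := affine (b - a) a.

(* [pinv setT f] is the two-sided inverse of f when f is bijective, see
   [affineK] and [simwK] below. *)
Definition neighbour_set alpha a b : set (R -> R) :=
  [set pinv setT (net_map a b) \o simw w |
     w in [set w | Lambda alpha w /\ `[a, b] `<=` simw w @` `[0, 1]]].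

Definition finite_neighbour K : Prop :=
  finite_set [set nbh : set (R -> R) | exists alpha a b,
    [/\ 0 < alpha, net_interval K alpha a b & nbh = neighbour_set alpha a b]].

Definition neighbour_maps V : set (R -> R) :=
  [set f | exists alpha u v,
    [/\ 0 < alpha, Lambda alpha u, Lambda alpha v,
        (simw u @` V) `&` (simw v @` V) !=set0
      & f = pinv setT (simw u) \o simw v]].

Definition invariant_set V : Prop := forall i, sim i @` V `<=` V.

Definition finite_type_for V : Prop :=
  [/\ V !=set0, bounded_set V, open V, invariant_set V
    & finite_set (neighbour_maps V)].

Definition convex_hull K : set R :=
  smallest [set A : set R^o | convex_set A] K.

Definition convex_gft K : Prop := finite_type_for (convex_hull K)°.

Definition separated_endpoints : Prop :=
  exists2 c : R, 0 < c & forall alpha, 0 < alpha <= 1 ->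
    forall u v, Lambda alpha u -> Lambda alpha v ->
    forall z w : R, [set 0; 1] z -> [set 0; 1] w ->
      simw u z = simw v w \/ c * alpha <= `|simw u z - simw v w|.

Lemma pinv_bijK (f : R -> R) : bijective f ->
  cancel f (pinv setT f) /\ cancel (pinv setT f) f.
Proof.
move=> bf; have fi := bij_inj bf; case: bf => g _ gK; split=> x.
  by apply: pinvKV => //; [move=> y z _ _; exact: fi | rewrite inE].
by apply: pinvK; rewrite inE; exists (g x).
Qed.

Lemma affine_bij (r d : R) : r != 0 -> bijective (affine r d).
Proof.
move=> r0; exists (fun y => (y - d) / r) => x; rewrite /affine.
  by rewrite addrK mulrAC divff ?mul1r.
by rewrite mulrC divfK ?subrK.
Qed.

Lemma affineK (r d : R) : r != 0 ->
  cancel (affine r d) (pinv setT (affine r d)) /\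
  cancel (pinv setT (affine r d)) (affine r d).
Proof. by move=> r0; exact/pinv_bijK/affine_bij. Qed.

Lemma simwK w : cancel (simw w) (pinv setT (simw w)) /\
  cancel (pinv setT (simw w)) (simw w).
Proof.
apply: pinv_bijK; elim: w => [|i w IH] /=; first by exists id.
apply: bij_comp IH; apply: affine_bij.
by have /andP[+ _] := ifs_ratio_bound S i; rewrite normr_gt0.
Qed.

End IFS.

(* Main.v *)
(* Write r_w for the ratio of S_w. By weak separation, only boundedly many maps
   S_w with w in Lambda_a have x in S_w([0,1]), so some pair (a0, x0) has the
   maximal number of them. Any copy of a maximal pair is maximal too: every S_t
   with t in Lambda_(|r_w| a0) and S_w(x0) in S_t([0,1]) is of the form S_w S_v
   with v in Lambda_a0. Putting such a copy inside S_u([0,1]) and S_v([0,1])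
   shows that S_u^-1 S_v takes finitely many values as long as these intervals
   have comparable lengths and overlap in a fixed proportion.
   Overlaps of a small proportion are excluded by removing last letters: either
   the parents already overlap in a fixed proportion, so that finitely many
   relative overlaps can occur, or the parents have exactly the same overlap,
   which is then relatively smaller still; at the empty words it would be all
   of [0,1]. This yields (1) => (3).
   Finally a net interval lies in some S_t([0,1]) with t in Lambda_a, and, as
   [0,1] is covered at every scale, its ends are S_t(e(z)) with z in {0,1} and
   e among the finitely many neighbour maps; hence (3) => (2) and (3) => (4). *)

Require Import Defs.
From mathcomp Require Import all_boot all_order all_algebra.
From mathcomp Require Import all_classical all_reals all_analysis.
From mathcomp Require Import ring lra.

Set Implicit Arguments.
Unset Strict Implicit.
Unset Printing Implicit Defensive.

Import Order.TTheory GRing.Theory Num.Theory.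
Import numFieldNormedType.Exports.

Local Open Scope classical_set_scope.
Local Open Scope ring_scope.

(** * Finite sets *)

Lemma finite_min {R : realType} (A : set R) (q : R) :
  finite_set A -> A q -> exists2 m, A m & forall x, A x -> m <= x.
Proof.
move=> /finite_seqP[s ->] {A} /=; elim: s q => [//|y s IH] q _.
have [->|] := eqVneq s [::].
  by exists y => [|x] /=; rewrite inE // => /eqP->.
rewrite -size_eq0 -lt0n => s0.
have [|m ms mP] := IH (nth 0 s 0); first exact: mem_nth.
have [ym|my] := leP y m.
  exists y; first by rewrite /= inE eqxx.
  by move=> x; rewrite /= inE => /orP[/eqP->|/mP]; [|exact: le_trans].
exists m; first by rewrite /= inE ms orbT.
by move=> x; rewrite /= inE => /orP[/eqP->|/mP]; [exact: ltW|].
Qed.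

Lemma finite_pos_lbound {R : realType} (A : set R) :
  finite_set A -> (forall x, A x -> 0 < x) ->
  exists2 c, 0 < c <= 1 & forall x, A x -> c <= x.
Proof.
move=> finA pos.
have finA1 : finite_set (1 |` A) by rewrite finite_setU; split.
have [m mA mP] := @finite_min _ (1 |` A) 1 finA1 (or_introl erefl).
exists m; last by move=> x Ax; apply: mP; right.
apply/andP; split; last by apply: mP; left.
by case: mA => [->|/pos].
Qed.

Lemma finite_next {R : realType} (A : set R) (p q : R) :
  finite_set A -> A q -> p < q ->
  exists b, [/\ A b, p < b, b <= q & forall h, A h -> ~ (p < h < b)].
Proof.
move=> finA Aq pq.
have [b [Ab pb] bP] := @finite_min _ (A `&` [set h | p < h]) q
  (finite_setIl _ finA) (conj Aq pq).
exists b; split=> //; first exact: bP.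
move=> h Ah /andP[ph hb]; have := bP h (conj Ah ph).
by rewrite leNgt hb.
Qed.

Lemma expr_small {R : realType} (x c : R) :
  0 <= x < 1 -> 0 < c -> exists n, x ^+ n < c.
Proof.
move=> /andP[x0 x1] c0; have x1' : `|x| < 1 by rewrite ger0_norm.
have [n _ nP] := cvgr_lt _ (cvg_expr x1') _ c0.
by exists n; apply: nP => /=.
Qed.

Lemma uniq_size_le_card (T : eqType) (I : finType) (g : T -> I) (s : seq T) :
  uniq s -> {in s &, injective g} -> (size s <= #|I|)%N.
Proof.
move=> us inj; rewrite -(size_map g).
have /card_uniqP <- : uniq (map g s) by rewrite map_inj_in_uniq.
exact: max_card.
Qed.

Lemma card_le_II_inj (T : Type) (A : set T) n : (A #<= `I_n)%card ->
  exists2 h : T -> nat, forall x, A x -> (h x < n)%N &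
    forall x y, A x -> A y -> h x = h y -> x = y.
Proof.
move=> /pcard_leP[h]; exists h => [x Ax|x y Ax Ay]; first by have hS := 'funS_h; exact: hS.
have hi := 'inj_h; exact: hi (mem_set Ax) (mem_set Ay).
Qed.

(** Applied to neighbour sets, which turn out to be subsets of one finite set of maps. *)
Lemma finite_subsets (T : Type) (F : set T) :
  finite_set F -> finite_set [set A | A `<=` F].
Proof.
case/finite_setP => n; elim: n F => [|n IH] F.
  rewrite II0 card_eq0 => /eqP->.
  by apply: sub_finite_set (finite_set1 set0) => A /=; rewrite subset0.
move=> /eq_cardSP[x Fx /IH finFx].
have := finite_image2 setU (finite_set2 set0 [set x]) finFx.
apply: sub_finite_set => A AF; exists (A `&` [set x]).
  have [Ax|nAx] := pselect (A x); [right|left]; apply/seteqP; split=> y //=.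
  - by case.
  - by move->.
  - by case=> Ay yx; apply: nAx; rewrite -yx.
exists (A `\ x); first by move=> y [Ay yx]; split=> //; exact: AF.
by apply/seteqP; split=> y /=; [case=> -[]|]; have [->|] := pselect (y = x); tauto.
Qed.

(** * Similarities and overlaps *)

(** For affine [f], [lo f] and [hi f] are the ends of f([0,1]), whatever the sign of the slope. *)
Definition lo {R : realType} (f : R -> R) : R := Num.min (f 0) (f 1).

Definition hi {R : realType} (f : R -> R) : R := Num.max (f 0) (f 1).

(* The length of f([0,1]) /\ g([0,1]) for affine f and g; it is negative or
   zero when the open intervals do not meet. *)
Definition overlap {R : realType} (f g : R -> R) : R :=
  Num.min (hi f) (hi g) - Num.max (lo f) (lo g).

Lemma overlapC {R : realType} (f g : R -> R) : overlap f g = overlap g f.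
Proof. by rewrite /overlap minC maxC. Qed.

Section Words.
Variables (R : realType) (k : nat) (S : ifs R k).
Implicit Types (u v w : seq 'I_k) (f g : R -> R).

Local Notation simw := (Defs.simw S).
Local Notation sim := (Defs.sim S).
Local Notation ratio := (Defs.ratio S).
Local Notation ratiow := (Defs.ratiow S).
Local Notation Lambda := (Defs.Lambda S).

Lemma ratiow_nil : ratiow [::] = 1.
Proof. by rewrite /Defs.ratiow big_nil. Qed.

Lemma ratiow_cons i w : ratiow (i :: w) = ratio i * ratiow w.
Proof. by rewrite /Defs.ratiow big_cons. Qed.

Lemma ratiow_cat u v : ratiow (u ++ v) = ratiow u * ratiow v.
Proof. by rewrite /Defs.ratiow big_cat. Qed.

Lemma ratiow_rcons w i : ratiow (rcons w i) = ratiow w * ratio i.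
Proof. by rewrite -cats1 ratiow_cat ratiow_cons ratiow_nil mulr1. Qed.

Lemma ratio_gt0 i : 0 < `|ratio i|.
Proof. by have /andP[] := ifs_ratio_bound S i. Qed.

Lemma ratio_lt1 i : `|ratio i| < 1.
Proof. by have /andP[] := ifs_ratio_bound S i. Qed.

Lemma ratiow_gt0 w : 0 < `|ratiow w|.
Proof.
elim: w => [|i w IH]; first by rewrite ratiow_nil normr1.
by rewrite ratiow_cons normrM mulr_gt0 ?ratio_gt0.
Qed.

Lemma ratiow_neq0 w : ratiow w != 0.
Proof. by rewrite -normr_gt0 ratiow_gt0. Qed.

Lemma ratiow_le1 w : `|ratiow w| <= 1.
Proof.
elim: w => [|i w IH]; first by rewrite ratiow_nil normr1.
by rewrite ratiow_cons normrM mulr_ile1 ?normr_ge0 // ltW ?ratio_lt1.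
Qed.

Lemma ratiow_eq1 w : `|ratiow w| = 1 -> w = [::].
Proof.
case: w => // i w; rewrite ratiow_cons normrM => e.
have := ratio_lt1 i; rewrite -e ltr_pMr ?ratio_gt0 //.
by rewrite ltNge ratiow_le1.
Qed.

Lemma simw_cat u v : simw (u ++ v) = simw u \o simw v.
Proof. by elim: u => //= i u ->. Qed.

Lemma simw_rcons w i : simw (rcons w i) = simw w \o sim i.
Proof. by rewrite -cats1 simw_cat. Qed.

Lemma simwE w x : simw w x = ratiow w * x + simw w 0.
Proof.
elim: w x => [|i w IH] x; first by rewrite ratiow_nil mul1r addr0.
by rewrite ratiow_cons /= /Defs.sim /affine IH mulrDr addrA mulrA.
Qed.

Lemma simwB w x y : simw w x - simw w y = ratiow w * (x - y).
Proof. by rewrite simwE [simw w y]simwE; ring. Qed.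

Lemma simw_inj w : injective (simw w).
Proof. exact: can_inj (simwK S w).1. Qed.

(** Describes a neighbour map of two arbitrarily long words [u] and [v] by extensions [v'] and [w]
    that can be kept in finite sets. *)
Lemma pinv_simw_eq u v v' w : simw v \o simw w = simw u \o simw v' ->
  pinv setT (simw u) \o simw v = simw v' \o pinv setT (simw w).
Proof.
move=> e; apply/funext => x /=; apply: (can_inj (simwK S u).1).
rewrite (simwK S u).2 -[LHS](congr1 (simw v) ((simwK S w).2 x)).
by rewrite -/((simw v \o simw w) _) e.
Qed.

Lemma simw_convex w x : simw w x = (1 - x) * simw w 0 + x * simw w 1.
Proof. by rewrite simwE [simw w 1]simwE; ring. Qed.

Lemma hiBlo w : hi (simw w) - lo (simw w) = `|ratiow w|.
Proof.
have := simwB w 1 0; rewrite subr0 mulr1 => <-; rewrite /hi /lo.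
by rewrite distrC; case: (leP (simw w 0) (simw w 1)) => h;
  [rewrite ler0_norm ?opprB ?subr_le0 | rewrite gtr0_norm ?subr_gt0].
Qed.

Lemma lo_lt_hi w : lo (simw w) < hi (simw w).
Proof. by rewrite -subr_gt0 hiBlo ratiow_gt0. Qed.

Lemma le_simw_pos w : 0 < ratiow w -> {mono simw w : x y / x <= y}.
Proof. by move=> r0 x y; rewrite -subr_ge0 simwB pmulr_rge0 // subr_ge0. Qed.

Lemma le_simw_neg w : ratiow w < 0 -> {mono simw w : x y /~ x <= y}.
Proof. by move=> r0 x y; rewrite -subr_ge0 simwB nmulr_rge0 // subr_le0. Qed.

Lemma mono_minmax (h : R -> R) : {mono h : x y / x <= y} -> forall x y,
  Num.min (h x) (h y) = h (Num.min x y) /\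
  Num.max (h x) (h y) = h (Num.max x y).
Proof.
move=> mono x y; case: (leP x y) => xy.
  by rewrite min_l ?max_r ?mono.
by rewrite min_r ?max_l ?mono // ltW.
Qed.

Lemma nmono_minmax (h : R -> R) : {mono h : x y /~ x <= y} -> forall x y,
  Num.min (h x) (h y) = h (Num.max x y) /\
  Num.max (h x) (h y) = h (Num.min x y).
Proof.
move=> mono x y; case: (leP x y) => xy.
  by rewrite min_r ?max_l ?mono.
by rewrite min_l ?max_r ?mono // ltW.
Qed.

Lemma lohi_simw_pos w f : 0 < ratiow w ->
  lo (simw w \o f) = simw w (lo f) /\ hi (simw w \o f) = simw w (hi f).
Proof.
move=> r0; have mm := mono_minmax (le_simw_pos r0).
by split; rewrite /lo /hi /= ?(mm _ _).1 ?(mm _ _).2.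
Qed.

Lemma lohi_simw_neg w f : ratiow w < 0 ->
  lo (simw w \o f) = simw w (hi f) /\ hi (simw w \o f) = simw w (lo f).
Proof.
move=> r0; have mm := nmono_minmax (le_simw_neg r0).
by split; rewrite /lo /hi /= ?(mm _ _).1 ?(mm _ _).2.
Qed.

Lemma overlap_comp w f g :
  overlap (simw w \o f) (simw w \o g) = `|ratiow w| * overlap f g.
Proof.
rewrite /overlap; have := ratiow_neq0 w; rewrite neq_lt => /orP[r0|r0].
  have [-> ->] := lohi_simw_neg f r0; have [-> ->] := lohi_simw_neg g r0.
  have mm := nmono_minmax (le_simw_neg r0).
  by rewrite (mm _ _).1 (mm _ _).2 simwB ltr0_norm //; ring.
have [-> ->] := lohi_simw_pos f r0; have [-> ->] := lohi_simw_pos g r0.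
have mm := mono_minmax (le_simw_pos r0).
by rewrite (mm _ _).1 (mm _ _).2 simwB gtr0_norm.
Qed.

Lemma lo_id : lo (@id R) = 0.
Proof. by rewrite /lo min_l ?ler01. Qed.

Lemma hi_id : hi (@id R) = 1.
Proof. by rewrite /hi max_r ?ler01. Qed.

Lemma simw_itvE w y :
  (lo (simw w) <= simw w y <= hi (simw w)) = (0 <= y <= 1) /\
  (lo (simw w) < simw w y < hi (simw w)) = (0 < y < 1).
Proof.
have := ratiow_neq0 w; rewrite neq_lt => /orP[r0|r0].
  have [l h] := lohi_simw_neg id r0; rewrite hi_id lo_id in l h.
  rewrite /comp in l h; rewrite l h; have mono := le_simw_neg r0.
  by split; rewrite ?mono ?(leW_nmono mono) andbC.
have [l h] := lohi_simw_pos id r0; rewrite hi_id lo_id in l h.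
rewrite /comp in l h; rewrite l h; have mono := le_simw_pos r0.
by split; rewrite ?mono ?(leW_mono mono).
Qed.

Lemma mem_simw_itv w x :
  (simw w @` `[0, 1]) x <-> lo (simw w) <= x <= hi (simw w).
Proof.
split=> [[y /=]|]; first by rewrite in_itv /= => y01 <-; rewrite (simw_itvE _ _).1.
move=> xw; exists (pinv setT (simw w) x); last exact: (simwK S w).2.
by rewrite /= in_itv /= -(simw_itvE w _).1 (simwK S w).2.
Qed.

Lemma mem_simw_oitv w x :
  (simw w @` `]0, 1[) x <-> lo (simw w) < x < hi (simw w).
Proof.
split=> [[y /=]|]; first by rewrite in_itv /= => y01 <-; rewrite (simw_itvE _ _).2.
move=> xw; exists (pinv setT (simw w) x); last exact: (simwK S w).2.
by rewrite /= in_itv /= -(simw_itvE w _).2 (simwK S w).2.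
Qed.

Lemma overlap_gt0P u v :
  (simw u @` `]0, 1[) `&` (simw v @` `]0, 1[) !=set0 <->
  0 < overlap (simw u) (simw v).
Proof.
rewrite subr_gt0 gt_max !lt_min; split.
  move=> [x []] /mem_simw_oitv /andP[ux xu] /mem_simw_oitv /andP[vx xv].
  by rewrite !lo_lt_hi (lt_trans ux xv) (lt_trans vx xu).
move=> /andP[/andP[a b] /andP[c d]].
pose p := Num.max (lo (simw u)) (lo (simw v)).
pose q := Num.min (hi (simw u)) (hi (simw v)).
have pq : p < q by rewrite gt_max !lt_min a b c.
exists ((p + q) / 2); have [pm mq] := (midf_lt pq).
move: pm mq; rewrite gt_max lt_min => /andP[x1 x2] /andP[x3 x4].
by split; [apply/mem_simw_oitv|apply/mem_simw_oitv]; apply/andP.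
Qed.

End Words.

(** * Words of a given generation *)

Section Generations.
Variables (R : realType) (k : nat) (S : ifs R k).
Implicit Types (u v w : seq 'I_k) (f g : R -> R).

Local Notation simw := (Defs.simw S).
Local Notation sim := (Defs.sim S).
Local Notation ratio := (Defs.ratio S).
Local Notation ratiow := (Defs.ratiow S).
Local Notation Lambda := (Defs.Lambda S).

Lemma ratio_lbound : exists2 c, 0 < c <= 1 & forall i, c <= `|ratio i|.
Proof.
have [c c01 cP] := @finite_pos_lbound R (range (fun i => `|ratio i|)) (finite_image _ finite_finset)
  (fun x '(ex_intro2 i _ e) => eq_ind _ (fun y => 0 < y) (ratio_gt0 S i) _ e).
by exists c => // i; apply: cP; exists i.
Qed.

Lemma ratio_ubound : exists2 c, 0 <= c < 1 & forall i, `|ratio i| <= c.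
Proof.
have pos x : range (fun i => 1 - `|ratio i|) x -> 0 < x.
  by move=> [i _ <-]; rewrite subr_gt0 ratio_lt1.
have [c /andP[c0 c1] cP] := finite_pos_lbound (finite_image _ finite_finset) pos.
exists (1 - c); first by rewrite subr_ge0 c1 ltrBlDr ltrDl.
by move=> i; rewrite lerBrDl -lerBrDr; apply: cP; exists i.
Qed.

Lemma word_pred_rcons w i : word_pred (rcons w i) = w.
Proof. by rewrite /word_pred size_rcons /= -cats1 take_size_cat. Qed.

Lemma Lambda_rcons a w i :
  Lambda a (rcons w i) <-> `|ratiow w| * `|ratio i| < a <= `|ratiow w|.
Proof.
rewrite /Defs.Lambda /= word_pred_rcons ratiow_rcons normrM.
by split=> [[]//|h]; split=> //; case: w {h}.
Qed.

Lemma LambdaE a w : Lambda a w -> exists v i, w = rcons v i.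
Proof. by case: (lastP w) => [[]//|v i _]; exists v, i. Qed.

Lemma Lambda_lt a w : Lambda a w -> `|ratiow w| < a.
Proof. by case=> _ /andP[]. Qed.

Lemma Lambda_gt0 a w : Lambda a w -> 0 < a.
Proof. by move/Lambda_lt; apply: le_lt_trans. Qed.

Lemma Lambda_le1 a w : Lambda a w -> a <= 1.
Proof. by case=> _ /andP[_ /le_trans]; apply; exact: ratiow_le1. Qed.

Lemma Lambda_ge c a w : 0 <= c -> (forall i, c <= `|ratio i|) ->
  Lambda a w -> c * a <= `|ratiow w|.
Proof.
move=> c0 cP aw; have [v [i wE]] := LambdaE aw.
have /ltW a0 := Lambda_gt0 aw.
move: aw; rewrite wE => /Lambda_rcons /andP[a1 a2].
by rewrite ratiow_rcons normrM mulrC ler_pM.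
Qed.

(** Prefixing [u] multiplies the ratios of a word and of its predecessor by |r_u|, so S_u carries
    generation [a] into generation |r_u| a. *)
Lemma Lambda_cat a u w : Lambda a w -> Lambda (`|ratiow u| * a) (u ++ w).
Proof.
move=> aw; have [v [i wE]] := LambdaE aw; move: aw; rewrite wE -rcons_cat.
move=> /Lambda_rcons /andP[a1 a2]; apply/Lambda_rcons.
by rewrite ratiow_cat normrM -mulrA ltr_pM2l ?ler_pM2l ?ratiow_gt0 // a1.
Qed.

Lemma finite_words n : finite_set [set w : seq 'I_k | (size w <= n)%N].
Proof.
elim: n => [|n IH].
  by apply: sub_finite_set (finite_set1 [::]) => w /=; case: w.
have fin2 := finite_image2 cons (@finite_finset _ [set: 'I_k]) IH.
apply: (@sub_finite_set _ _ ([set [::]] `|` _)).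
  2: by rewrite finite_setU; split; [exact: finite_set1|exact: fin2].
move=> [|i w] /=; first by left.
by move=> sw; right; exists i => //; exists w.
Qed.

(** The predecessor of such a word has ratio at least [c], while ratios decay geometrically with the
    length; hence the length is bounded. *)
Lemma finite_Lambda_ge c : 0 < c ->
  finite_set [set w | exists2 a, c <= a & Lambda a w].
Proof.
move=> c0; have [rho /andP[rho0 rho1] rhoP] := ratio_ubound.
have [n nP] := expr_small (introT andP (conj rho0 rho1)) c0.
have ratiow_le w : `|ratiow w| <= rho ^+ size w.
  elim: w => [|i w IH]; first by rewrite ratiow_nil normr1 expr0.
  by rewrite ratiow_cons normrM exprS ler_pM.
apply: sub_finite_set (finite_words n) => w /= [a ca aw].
have [v [i wE]] := LambdaE aw; move: aw; rewrite wE => /Lambda_rcons /andP[_ av].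
rewrite size_rcons ltnNge; apply/negP => nv.
have := le_trans (le_trans ca av) (ratiow_le v); apply/negP; rewrite -ltNge.
by apply: le_lt_trans nP; rewrite ler_wiXn2l // ltW.
Qed.

Lemma finite_Lambda a : 0 < a -> finite_set (Lambda a).
Proof.
move=> a0; apply: sub_finite_set (finite_Lambda_ge a0) => w aw.
by exists a.
Qed.

(** * Words when the self-similar set is [0,1] *)

Hypothesis K_unit : self_similar_set S `[0, 1].

Lemma sim_unit i x : 0 <= x <= 1 -> 0 <= sim i x <= 1.
Proof.
case: K_unit => _ _ e x01; have : `[0%R, 1%R]%classic (sim i x).
  by rewrite e; exists i => //; exists x => //=; rewrite in_itv.
by rewrite /= in_itv.
Qed.

Lemma unit_sim x : 0 <= x <= 1 -> exists i, exists2 y, 0 <= y <= 1 & sim i y = x.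
Proof.
case: K_unit => _ _ e x01; have : `[0%R, 1%R]%classic x by rewrite /= in_itv.
by rewrite e => -[i _ [y]] /=; rewrite in_itv => y01 <-; exists i, y.
Qed.

Lemma simw_unit w x : 0 <= x <= 1 -> 0 <= simw w x <= 1.
Proof. by elim: w => //= i w IH /IH; exact: sim_unit. Qed.

Lemma lohi_unit w : 0 <= lo (simw w) /\ hi (simw w) <= 1.
Proof.
have /andP[a b] : 0 <= simw w 0 <= 1 by apply: simw_unit; rewrite lexx ler01.
have /andP[c d] : 0 <= simw w 1 <= 1 by apply: simw_unit; rewrite lexx ler01.
by rewrite /lo /hi le_min ge_max a b c d.
Qed.

(** Choose a letter i with x = S_i(y). If |r_i| < a, the one-letter word is enough; otherwise y is
    covered at scale a / |r_i|. The recursion is on an n with rho^n < a, which drops by one at each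
    letter. *)
Lemma Lambda_cover a x : 0 < a <= 1 -> 0 <= x <= 1 ->
  exists2 w, Lambda a w & lo (simw w) <= x <= hi (simw w).
Proof.
have [rho /andP[rho0 rho1] rhoP] := ratio_ubound.
move=> a01 x01; have [n nP] := expr_small (introT andP (conj rho0 rho1)) (andP a01).1.
suff [w aw /mem_simw_itv xw] : exists2 w, Lambda a w & (simw w @` `[0, 1]) x.
  by exists w.
elim: n a x a01 x01 nP => [|n IH] a x /andP[a0 a1] x01.
  by rewrite expr0 ltNge a1.
rewrite exprS => an; have [i [y y01 yx]] := unit_sim x01.
have [ai|ia] := ltP `|ratio i| a.
  exists [:: i]; last by exists y; rewrite //= in_itv.
  by apply/(Lambda_rcons a [::] i); rewrite ratiow_nil normr1 mul1r ai.
have i0 := ratio_gt0 S i.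
have [|//||w aw yw] := IH (a / `|ratio i|) y.
- by rewrite divr_gt0 //= ler_pdivrMr // mul1r.
- rewrite ltr_pdivlMr //; apply: le_lt_trans an.
  by rewrite mulrC ler_wpM2r // exprn_ge0.
exists (i :: w); last by case: yw => z z01 zy; exists z => //=; rewrite zy.
have := @Lambda_cat _ [:: i] _ aw; rewrite ratiow_cons ratiow_nil mulr1.
by rewrite mulrC divfK // gt_eqF.
Qed.

(** [d] is below finitely many positive numbers: the ratios, and the non-zero distances from the
    ends of S_i([0,1]) to the corresponding ends of [0,1]. *)
Lemma sim_gap : exists2 d, 0 < d <= 1 & forall i,
  [/\ d <= `|ratio i|, lo (sim i) = 0 \/ d <= lo (sim i)
    & hi (sim i) = 1 \/ hi (sim i) <= 1 - d].
Proof.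
pose A1 := [set `|ratio i| | i in [set: 'I_k]].
pose A2 := [set lo (sim i) | i in [set: 'I_k]].
pose A3 := [set 1 - hi (sim i) | i in [set: 'I_k]].
pose A := (A1 `|` A2 `|` A3) `&` [set x | 0 < x].
have finA : finite_set A.
  apply: finite_setIl; rewrite !finite_setU.
  by split; [split|]; exact: finite_image _ finite_finset.
have [d d01 dP] := finite_pos_lbound finA (fun x => @proj2 _ _).
exists d => // i; have [l h] : 0 <= lo (sim i) /\ hi (sim i) <= 1 := lohi_unit [:: i].
split.
- by apply: dP; split; [left; left; exists i|exact: ratio_gt0].
- move: l; rewrite le_eqVlt => /orP[/eqP<-|l]; [by left|right].
  by apply: dP; split; [left; right; exists i|].
- move: h; rewrite le_eqVlt => /orP[/eqP<-|h]; [by left|right].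
  rewrite lerBrDr addrC -lerBrDr.
  by apply: dP; split; [right; exists i|rewrite /= subr_gt0].
Qed.

End Generations.

(** * Finiteness of large overlaps *)

Section LargeOverlaps.
Variables (R : realType) (k : nat) (S : ifs R k).
Implicit Types (u v w : seq 'I_k) (f g : R -> R).

Local Notation simw := (Defs.simw S).
Local Notation sim := (Defs.sim S).
Local Notation ratio := (Defs.ratio S).
Local Notation ratiow := (Defs.ratiow S).
Local Notation Lambda := (Defs.Lambda S).

Hypothesis K_unit : self_similar_set S `[0, 1].

Lemma overlap_le u v : overlap (simw u) (simw v) <= `|ratiow v|.
Proof.
rewrite overlapC -(hiBlo S) /overlap.
by apply: lerB; [rewrite ge_min|rewrite le_max]; rewrite lexx.
Qed.

(** If [x0] were fixed by all S_w, the intervals S_w([0,1]) of a small generation would all lie near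
    [x0], although they cover [0,1]. *)
Lemma orbit_nonconst (x0 : R) : exists u, simw u x0 != x0.
Proof.
apply: contrapT => nex; have fix_x0 u : simw u x0 = x0.
  by apply: contrapT => /eqP ux0; apply: nex; exists u.
have close x : 0 <= x <= 1 -> `|x - x0| < 2^-1.
  move=> x01; have B0 : 0 < 1 + `|x0| by rewrite ltr_pwDl.
  pose a := (2 * (1 + `|x0|))^-1.
  have a01 : 0 < a <= 1.
    by rewrite invr_gt0 mulr_gt0 //= invf_le1 ?mulr_gt0 //; have := normr_ge0 x0; lra.
  have [w aw /mem_simw_itv[y + <-]] := Lambda_cover K_unit a01 x01.
  rewrite /= in_itv /= => /andP[y0 y1].
  rewrite -{1}(fix_x0 w).
  have yx : `|y - x0| <= 1 + `|x0|.
    by apply: le_trans (ler_normB _ _) _; rewrite lerD2r ger0_norm.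
  rewrite simwB normrM; apply: le_lt_trans (_ : _ <= `|ratiow w| * (1 + `|x0|)) _.
    by rewrite ler_wpM2l.
  rewrite -ltr_pdivlMr // (lt_le_trans (Lambda_lt aw)) //.
  by rewrite /a invfM.
have := close 0; have := close 1; rewrite !lexx !ler01 => /(_ isT) c1 /(_ isT) c0.
have := ler_distD x0 1 0; rewrite subr0 normr1 leNgt => /negP; apply.
by rewrite [X in _ < X](splitr 1) mul1r ltrD // distrC.
Qed.

(** Maps are listed rather than words, since distinct words may define the same similarity. *)
Definition covering_maps (a x : R) (s : seq (R -> R)) :=
  forall f, f \in s -> exists2 w, Lambda a w & f = simw w /\ lo f <= x <= hi f.

(** A similarity is determined by its values at the distinct points [x0] and S_u(x0). If f([0,1])
    contains x, both values lie within a fixed multiple of a from x, hence in finitely many balls of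
    radius a, each holding at most [N] such values. *)
Lemma weak_separation_bound : weak_separation S -> exists N, forall a x s,
  uniq s -> covering_maps a x s -> (size s <= N)%N.
Proof.
move=> [x0 [N wsc]]; have [u ux0] := orbit_nonconst x0.
(* If x = f(z) with z in [0,1], then |f(S_v(x0)) - x| <= a |S_v(x0) - z| <= a (|x0| + 1) <= a M, so
   the balls of radius a centred at x + (j - M) a with j <= J suffice. *)
pose M := (Num.truncn (2 + `|x0|)).+1; pose J := (2 * M)%N.
exists #|{: ('I_J.+1 * 'I_N.+1) * ('I_J.+1 * 'I_N.+1)}| => a x s us cover.
have [a0|a0] := leP a 0.
  case: s cover {us} => // f s /(_ f); rewrite inE eqxx => /(_ isT)[w aw _].
  by have := Lambda_gt0 aw; rewrite ltNge a0.
pose ball (j : nat) v := closed_ball (x + (j%:R - M%:R) * a) a `&`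
  [set simw w (simw v x0) | w in Lambda a].
have /choice[phi phiP] : forall jv : nat * seq 'I_k, exists h : R -> nat,
    (forall y, ball jv.1 jv.2 y -> (h y < N)%N) /\
    forall y z, ball jv.1 jv.2 y -> ball jv.1 jv.2 z -> h y = h z -> y = z.
  by move=> [j v]; have [h h1 h2] := card_le_II_inj (wsc a a0 v (x + (j%:R - M%:R) * a)); exists h.
pose idx (y : R) := Num.truncn ((y - x) / a + M%:R).
have idxP f v : f \in s -> (idx (f (simw v x0)) <= J)%N /\
    ball (idx (f (simw v x0))) v (f (simw v x0)).
  move=> /cover[w aw [-> /mem_simw_itv[z + zx]]]; rewrite /= in_itv /= => /andP[z0 z1].
  have /andP[v0 v1] : 0 <= simw v 0 <= 1 by rewrite simw_unit // lexx ler01.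
  set y := simw w _; set t := (y - x) / a.
  have vz : `|simw v x0 - z| <= M%:R.
    apply: le_trans (ltW (truncnS_gt (2 + `|x0|))).
    apply: le_trans (ler_distD (simw v 0) _ _) _; rewrite simwB subr0 normrM.
    apply: le_trans (_ : `|x0| + 1 <= _); last by lra.
    rewrite lerD ?ler_piMl ?ratiow_le1 // ler_norml; lra.
  have tM : `|t| <= M%:R.
    rewrite normrM normfV (gtr0_norm a0) ler_pdivrMr // mulrC.
    by rewrite /y -zx simwB normrM ler_pM // ltW // (Lambda_lt aw).
  have tE : y = x + t * a by rewrite /t divfK ?gt_eqF // subrKC.
  move: tM; rewrite ler_norml => /andP[tM Mt].
  have T0 : 0 <= t + M%:R by lra.
  have /andP[j1 j2] := truncn_itv T0; rewrite -/(idx y) in j1 j2.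
  split.
    by rewrite /J mul2n -addnn -(ler_nat R) natrD (le_trans j1) // lerD2r.
  split; last by exists w.
  rewrite closed_ballE // /closed_ball_ /=.
  have -> : x + ((idx y)%:R - M%:R) * a - y = ((idx y)%:R - M%:R - t) * a.
    by move: (idx y) => n; rewrite tE; ring.
  rewrite normrM (gtr0_norm a0) ler_piMl ?(ltW a0) // ler_norml.
  by move: j2; rewrite -natr1 => j2; lra.
pose code f v : 'I_J.+1 * 'I_N.+1 := let y := f (simw v x0) in
  (inord (idx y), inord (phi (idx y, v) y)).
have codeP f g v : f \in s -> g \in s -> code f v = code g v ->
    f (simw v x0) = g (simw v x0).
  move=> fs gs; have [fJ fb] := idxP f v fs; have [gJ gb] := idxP g v gs.
  case=> /(congr1 val); rewrite /= !inordK // => eJ.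
  rewrite -eJ in gb *; have [ph1 ph2] := phiP (idx (f (simw v x0)), v).
  move=> /(congr1 val); rewrite /= !inordK; first exact: ph2.
    exact/ltnW/ph1.
  exact/ltnW/ph1.
apply: (@uniq_size_le_card _ _ (fun f => (code f [::], code f u))) => // f g fs gs e.
have e1 := codeP f g [::] fs gs (congr1 fst e).
have e2 := codeP f g u fs gs (congr1 snd e).
have [[w aw [fw _]] [w' aw' [gw' _]]] := (cover f fs, cover g gs).
rewrite /= in e1; rewrite fw gw' in e1 e2 *.
have : (ratiow w - ratiow w') * (simw u x0 - x0) = 0.
  by rewrite mulrBl -!simwB e1 e2 subrr.
move/eqP; rewrite mulf_eq0 !subr_eq0 (negbTE ux0) orbF => /eqP er.
by apply/funext => y; rewrite simwE [RHS]simwE er; move: e1; rewrite simwE [RHS]simwE er => /addrI->.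
Qed.

(** Take (a, x) with the largest possible number n of covering maps. Composing them with S_w gives n
    covering maps at scale |r_w| a and point S_w(x); a map S_t not of this form would be one
    more. *)
Lemma maximal_configuration : weak_separation S -> exists a x, [/\ 0 < a <= 1,
  0 <= x <= 1 & forall w t, Lambda (`|ratiow w| * a) t ->
    lo (simw t) <= simw w x <= hi (simw t) ->
    exists2 v, Lambda a v & simw t = simw w \o simw v].
Proof.
move=> /weak_separation_bound[N boundN].
pose P n := `[< exists a x s, [/\ 0 < a <= 1, 0 <= x <= 1, uniq s,
  covering_maps a x s & size s = n] >].
have P0 : exists n, P n.
  by exists 0%N; apply/asboolP; exists 1, 0, [::]; rewrite ltr01 !lexx ler01.
have PN n : P n -> (n <= N)%N.
  by move=> /asboolP[a [x [s [_ _ us cov <-]]]]; exact: boundN cov.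
have [n /asboolP[a [x [s [a01 x01 us cov sn]]]] nmax] := ex_maxnP P0 PN.
exists a, x; split=> // w t at_ tx; apply: contrapT => nov.
have : P n.+1; last by move/nmax; rewrite ltnn.
apply/asboolP; exists (`|ratiow w| * a), (simw w x), (simw t :: map (fun f => simw w \o f) s).
split.
- have /andP[a0 a1] := a01; rewrite mulr_gt0 ?ratiow_gt0 //=.
  by rewrite mulr_ile1 ?ratiow_le1 // ltW.
- exact: simw_unit.
- rewrite /= map_inj_uniq ?us ?andbT.
    apply/negP => /mapP[f /cov[v av [-> _]] e]; apply: nov; by exists v.
  move=> f g e; apply/funext => y; apply: (@simw_inj _ _ S w).
  by move/(congr1 (fun h : R -> R => h y)): e.
- move=> f; rewrite inE => /orP[/eqP->|/mapP[g /cov[v av [-> vx]] ->]].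
    by exists t.
  exists (w ++ v); first exact: Lambda_cat.
  rewrite -simw_cat; split=> //; apply/mem_simw_itv; rewrite simw_cat.
  by move/mem_simw_itv: vx => [y y01 <-]; exists y.
- by rewrite /= size_map sn.
Qed.

(** The middle of the overlap lies in some S_(uu')([0,1]) too short to leave S_v([0,1]). The copy
    S_(uu')(x) of the maximal point is then covered by some S_(vv') of the matching generation, and
    maximality gives S_v S_v' = S_u S_u' S_w. So S_u^-1 S_v = S_u' S_w S_v'^-1, where u', w and v'
    come from finite sets. *)
Lemma finite_big_overlaps (d : R) : weak_separation S -> 0 < d <= 1 ->
  finite_set [set f | exists u v, [/\ d * `|ratiow v| <= `|ratiow u|,
    d * `|ratiow u| <= overlap (simw u) (simw v)
    & f = pinv setT (simw u) \o simw v]].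
Proof.
move=> /maximal_configuration[a [x [/andP[a0 a1] x01 maxP]]] /andP[d0 d1].
have [c /andP[c0 _] cP] := ratio_lbound S.
have d2 : 0 < d / 2 by rewrite divr_gt0.
pose e := d * (c * (d / 2)) * a.
have e0 : 0 < e by rewrite !mulr_gt0.
apply: (@sub_finite_set _ _ [set simw w \o pinv setT (simw w') |
    w in [set u ++ v | u in Lambda (d / 2) & v in Lambda a] &
    w' in [set w | exists2 b, e <= b & Lambda b w]]); last first.
  apply: finite_image2; last exact: finite_Lambda_ge.
  by apply: finite_image2; exact: finite_Lambda.
move=> _ [u [v [duv uv_ov ->]]].
set lu := `|ratiow u| in duv uv_ov; set lv := `|ratiow v| in duv.
have [lu0 lv0] : 0 < lu /\ 0 < lv by rewrite !ratiow_gt0.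
have dulv : d * lu <= lv by exact: le_trans uv_ov (overlap_le _ _).
pose p := Num.max (lo (simw u)) (lo (simw v)).
pose q := Num.min (hi (simw u)) (hi (simw v)).
have pq : d * lu <= q - p by [].
have dlu0 : 0 < d * lu by rewrite mulr_gt0.
have [[pu pv] [qu qv]] : (lo (simw u) <= p /\ lo (simw v) <= p) /\
    (q <= hi (simw u) /\ q <= hi (simw v)).
  rewrite /p /q; move: (lo _) (lo _) (hi _) (hi _) => ? ? ? ?.
  by rewrite !le_max !ge_min !lexx !orbT.
have /mem_simw_itv[y + yE] : lo (simw u) <= (p + q) / 2 <= hi (simw u).
  by apply/andP; split; lra.
rewrite /= in_itv /= => y01.
(* At scale d / 2 the interval of uu' is shorter than half the overlap; containing its midpoint, it
   stays within the overlap. *)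
have [||u' au' /mem_simw_itv[z z01 zy]] := @Lambda_cover _ _ _ K_unit (d / 2) y.
- by rewrite d2 /=; lra.
- by [].
have /mem_simw_itv /andP[m1 m2] : (simw (u ++ u') @` `[0, 1]) ((p + q) / 2).
  by exists z => //; rewrite simw_cat /= zy.
have len := hiBlo S (u ++ u'); rewrite ratiow_cat normrM -/lu in len.
have lu'd := Lambda_lt au'; set lu' := `|ratiow u'| in len lu'd.
have lu'0 : 0 < lu' by exact: ratiow_gt0.
have lulu' : lu * lu' < d * lu / 2.
  by rewrite -mulrA [d * _]mulrC -mulrA ltr_pM2l // mulrC.
have /mem_simw_itv /andP[x1 x2] : (simw (u ++ u') @` `[0, 1]) (simw (u ++ u') x).
  by exists x => //=; rewrite in_itv.
have /mem_simw_itv[y' + y'x] : lo (simw v) <= simw (u ++ u') x <= hi (simw v).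
  by apply/andP; split; lra.
rewrite /= in_itv /= => y'01.
(* Chosen so that |r_v| g = |r_(uu')| a, the generation at which maximality applies; [e] is a lower
   bound for it. *)
pose g := lu * lu' * a / lv.
have g0 : 0 < g by rewrite divr_gt0 ?mulr_gt0.
have [||v' gv' /mem_simw_itv[z' z'01 z'y']] := @Lambda_cover _ _ _ K_unit g y'.
- rewrite g0 ler_pdivrMr // mul1r.
  apply: le_trans (_ : lu * lu' <= _); first by rewrite ler_piMr // mulr_ge0 // ltW.
  by lra.
- by [].
have [||w aw wE] := maxP (u ++ u') (v ++ v') _ _.
- have <- : lv * g = `|ratiow (u ++ u')| * a.
    by rewrite ratiow_cat normrM mulrC divfK // gt_eqF.
  exact: Lambda_cat.
- by apply/mem_simw_itv; exists z' => //; rewrite simw_cat /= z'y' y'x.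
exists (u' ++ w); first by exists u' => //; exists w.
exists v'; last first.
  by apply/esym/pinv_simw_eq; rewrite -!simw_cat wE -simw_cat catA.
exists g => //; rewrite /e /g.
have lu'c : c * (d / 2) <= lu' by exact: Lambda_ge (ltW c0) cP au'.
rewrite ler_pdivlMr //.
have -> : d * (c * (d / 2)) * a * lv = d * lv * (c * (d / 2)) * a by ring.
by rewrite ler_wpM2r ?ler_pM // ?mulr_ge0 // ltW.
Qed.

End LargeOverlaps.

(** * Exclusion of small overlaps *)

(** Here [a1, a2] is a child of [a1', a2']: each end stays or moves inwards by at least e. Since the
    child and [b1, b2] meet and have length at least e, a moved end cutting the parent overlap would
    force that overlap to be at least e. *)
Lemma overlap_trim (R : realType) (a1' a1 a2 a2' b1 b2 e : R) : 0 < e ->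
  a1 = a1' \/ a1' + e <= a1 -> a2 = a2' \/ a2 <= a2' - e ->
  e <= a2 - a1 -> e <= b2 - b1 -> a1 < b2 -> b1 < a2 ->
  Num.min a2' b2 - Num.max a1' b1 < e ->
  Num.min a2 b2 - Num.max a1 b1 = Num.min a2' b2 - Num.max a1' b1.
Proof.
move=> e0 h1 h2 h3 h4 h5 h6.
case: (leP a2' b2) => g1; case: (leP a1' b1) => g2; case: (leP a2 b2) => g3;
  case: (leP a1 b1) => g4 h7; case: h1 => h1; case: h2 => h2; lra.
Qed.

Section SmallOverlaps.
Variables (R : realType) (k : nat) (S : ifs R k).
Implicit Types (u v w : seq 'I_k) (f g : R -> R).

Local Notation simw := (Defs.simw S).
Local Notation sim := (Defs.sim S).
Local Notation ratio := (Defs.ratio S).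
Local Notation ratiow := (Defs.ratiow S).
Local Notation Lambda := (Defs.Lambda S).

Hypothesis K_unit : self_similar_set S `[0, 1].

(** S_u carries the alternatives for S_i to S_u([0,1]), scaled by |r_u|; a negative ratio exchanges
    the two ends. *)
Lemma lohi_rcons (d : R) u i : lo (sim i) = 0 \/ d <= lo (sim i) ->
  hi (sim i) = 1 \/ hi (sim i) <= 1 - d ->
  (lo (simw (rcons u i)) = lo (simw u) \/
     lo (simw u) + d * `|ratiow u| <= lo (simw (rcons u i))) /\
  (hi (simw (rcons u i)) = hi (simw u) \/
     hi (simw (rcons u i)) <= hi (simw u) - d * `|ratiow u|).
Proof.
move=> dlo dhi; rewrite simw_rcons.
have := ratiow_neq0 S u; rewrite neq_lt => /orP[r0|r0].
  have [-> ->] := lohi_simw_neg (sim i) r0.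
  have [l h] := lohi_simw_neg id r0; rewrite hi_id lo_id /comp in l h.
  rewrite l h ltr0_norm // ![simw u (_ (sim i))]simwE [simw u 1]simwE.
  split; [case: dhi => [->|dhi]|case: dlo => [->|dlo]].
  - by left.
  - right; rewrite -subr_ge0.
    rewrite (_ : _ - _ = ratiow u * (hi (sim i) - (1 - d))); last by ring.
    by rewrite nmulr_rge0 // subr_le0.
  - by left; rewrite mulr0 add0r.
  - right; rewrite -subr_ge0.
    rewrite (_ : _ - _ = ratiow u * (d - lo (sim i))); last by ring.
    by rewrite nmulr_rge0 // subr_le0.
have [-> ->] := lohi_simw_pos (sim i) r0.
have [l h] := lohi_simw_pos id r0; rewrite hi_id lo_id /comp in l h.
rewrite l h gtr0_norm // ![simw u (_ (sim i))]simwE [simw u 1]simwE.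
split; [case: dlo => [->|dlo]|case: dhi => [->|dhi]].
- by left; rewrite mulr0 add0r.
- right; rewrite -subr_ge0.
  rewrite (_ : _ - _ = ratiow u * (lo (sim i) - d)); last by ring.
  by rewrite pmulr_rge0 // subr_ge0.
- by left.
- right; rewrite -subr_ge0.
  rewrite (_ : _ - _ = ratiow u * (1 - d - hi (sim i))); last by ring.
  by rewrite pmulr_rge0 // subr_ge0.
Qed.

Lemma overlapxx u : overlap (simw u) (simw u) = `|ratiow u|.
Proof. by rewrite /overlap minxx maxxx hiBlo. Qed.

(** Induction on the total length, removing the last letter of the word of smaller ratio, which
    keeps the two ratios comparable up to [d]. A large parent overlap leaves finitely many relative
    positions; a small one equals the original overlap and is bounded by induction. *)
Lemma overlap_lbound (d : R) : weak_separation S -> 0 < d <= 1 ->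
  (forall i, [/\ d <= `|ratio i|, lo (sim i) = 0 \/ d <= lo (sim i)
    & hi (sim i) = 1 \/ hi (sim i) <= 1 - d]) ->
  exists2 c, 0 < c <= 1 & forall u v,
    d * `|ratiow u| <= `|ratiow v| -> d * `|ratiow v| <= `|ratiow u| ->
    0 < overlap (simw u) (simw v) ->
    c * `|ratiow u| <= overlap (simw u) (simw v).
Proof.
move=> wsc d01 gap; have finG := finite_big_overlaps K_unit wsc d01.
have /andP[d0 d1] := d01.
set G := (X in finite_set X) in finG.
pose A := [set overlap (sim i) f | i in [set: 'I_k] & f in G] `&` [set x | 0 < x].
have [c /andP[c0 c1] cP] : exists2 c, 0 < c <= 1 & forall x, A x -> c <= x.
  apply: finite_pos_lbound => [|x []//].
  by apply: finite_setIl; apply: finite_image2 => //; exact: finite_finset.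
have cd0 : 0 < c * d by rewrite mulr_gt0.
have cd1 : c * d <= 1 by rewrite mulr_ile1 // ltW.
(* The factor [d] makes the bound hold relative to the longer interval too, whose length is at most
   1/d times that of the shorter. *)
exists (c * d); first by rewrite cd0.
suff main n u v : (size u + size v <= n)%N -> `|ratiow u| <= `|ratiow v| ->
    d * `|ratiow v| <= `|ratiow u| -> 0 < overlap (simw u) (simw v) ->
    c * d * `|ratiow u| <= overlap (simw u) (simw v) /\
    c * d * `|ratiow v| <= overlap (simw u) (simw v).
  move=> u v duv dvu ov; have [uv|/ltW vu] := leP `|ratiow u| `|ratiow v|.
    exact: (main _ u v (leqnn _) uv dvu ov).1.
  by rewrite overlapC in ov *; exact: (main _ v u (leqnn _) vu duv ov).2.
elim: n u v => [|n IH] u v; case/lastP: u => [|u' i].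
- move=> + + _ _; rewrite leqn0 addn_eq0 => /andP[_ /nilP->] _.
  by rewrite overlapxx ratiow_nil normr1 mulr1.
- by rewrite size_rcons addSn.
(* The empty word has the smaller ratio only if both words are empty; both intervals are then
   [0,1]. *)
- rewrite ratiow_nil normr1 => _ v1 _ _.
  have /(@ratiow_eq1 _ _ S) -> : `|ratiow v| = 1 by apply/eqP; rewrite eq_le v1 ratiow_le1.
  by rewrite overlapxx ratiow_nil normr1 mulr1.
rewrite size_rcons addSn ltnS => size_n uv dvu ov.
have [di dlo dhi] := gap i; have [glo ghi] := lohi_rcons u' dlo dhi.
set u := rcons u' i in uv dvu ov glo ghi *.
have uE : `|ratiow u| = `|ratiow u'| * `|ratio i| by rewrite ratiow_rcons normrM.
have u'0 := ratiow_gt0 S u'; have v0 := ratiow_gt0 S v.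
have du'u : d * `|ratiow u'| <= `|ratiow u| by rewrite uE mulrC ler_wpM2l.
have uu' : `|ratiow u| <= `|ratiow u'| by rewrite uE ler_piMr // ltW // ratio_lt1.
have du'v := le_trans du'u uv; have dvu' := le_trans dvu uu'.
have du'0 : 0 < d * `|ratiow u'| by rewrite mulr_gt0.
have ov_le : overlap (simw u) (simw v) <= overlap (simw u') (simw v).
  have l1 : lo (simw u') <= lo (simw u) by case: glo => ?; lra.
  have h1 : hi (simw u) <= hi (simw u') by case: ghi => ?; lra.
  apply: lerB; first by rewrite le_min !ge_min h1 lexx orbT.
  by rewrite ge_max !le_max l1 lexx orbT.
have ov' := lt_le_trans ov ov_le.
have [IH1 IH2] : c * d * `|ratiow u'| <= overlap (simw u') (simw v) /\
    c * d * `|ratiow v| <= overlap (simw u') (simw v).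
  have [u'v|/ltW vu'] := leP `|ratiow u'| `|ratiow v|; first exact: IH.
  by rewrite overlapC in ov' *; apply/and_comm; apply: IH => //; rewrite addnC.
have [big|small] := leP (d * `|ratiow u'|) (overlap (simw u') (simw v)).
  pose f := pinv setT (simw u') \o simw v.
  have ovE : overlap (simw u) (simw v) = `|ratiow u'| * overlap (sim i) f.
    rewrite -overlap_comp -simw_rcons; congr overlap.
    by apply/funext => x; rewrite /f /= (simwK S u').2.
  have cf : c <= overlap (sim i) f.
    apply: cP; split; last by move: ov; rewrite ovE pmulr_rgt0.
    by exists i => //; exists f => //; exists u', v.
  have cu' : c * `|ratiow u'| <= overlap (simw u) (simw v).
    by rewrite ovE mulrC ler_wpM2l.
  split; apply: le_trans cu'; rewrite -mulrA ler_wpM2l ?(ltW c0) //.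
  by apply: le_trans uu'; rewrite ler_piMl.
(* The parent overlap is too small to be cut by the last letter. *)
have ovE : overlap (simw u) (simw v) = overlap (simw u') (simw v).
  move: ov; rewrite subr_gt0 gt_max !lt_min => /andP[/andP[_ x1] /andP[x2 _]].
  apply: overlap_trim du'0 glo ghi _ _ x1 x2 small; by rewrite hiBlo.
rewrite ovE; split => //.
by apply: le_trans IH1; rewrite ler_wpM2l // ltW.
Qed.

End SmallOverlaps.

(** * The equivalence *)

Section Equivalence.
Variables (R : realType) (k : nat) (S : ifs R k).
Implicit Types (u v w : seq 'I_k) (f g : R -> R).

Local Notation simw := (Defs.simw S).
Local Notation sim := (Defs.sim S).
Local Notation ratio := (Defs.ratio S).
Local Notation ratiow := (Defs.ratiow S).
Local Notation Lambda := (Defs.Lambda S).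

(** Its finiteness is the convex generalized finite type condition, see [convex_gftE]; the other
    conditions are compared with it. *)
Definition unit_neighbour_maps : set (R -> R) := neighbour_maps S `]0, 1[.

(** * Endpoints and net intervals *)

Lemma endpoints_end a u (z : R) : Lambda a u -> [set 0; 1] z ->
  endpoints S a (simw u z).
Proof. by move=> au [->|->]; [left|right]; exists u. Qed.

Lemma endpointsE a (x : R) : endpoints S a x ->
  exists u z, [/\ Lambda a u, [set 0; 1] z & x = simw u z].
Proof. by move=> [] [u au <-]; exists u; [exists 0|exists 1]; split=> //; [left|right]. Qed.

Lemma finite_endpoints (a : R) : 0 < a -> finite_set (endpoints S a).
Proof.
by move=> a0; rewrite finite_setU; split; apply: finite_image; exact: finite_Lambda.
Qed.

Lemma endpoints_lohi a u : Lambda a u ->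
  endpoints S a (lo (simw u)) /\ endpoints S a (hi (simw u)).
Proof.
move=> au; have e0 := endpoints_end au (or_introl erefl).
have e1 := endpoints_end au (or_intror erefl).
by rewrite /lo /hi; case: leP.
Qed.

Hypothesis K_unit : self_similar_set S `[0, 1].

Lemma endpoints_unit a (x : R) : endpoints S a x -> 0 <= x <= 1.
Proof.
move=> /endpointsE[u [z [_ z01 ->]]]; apply: simw_unit => //.
by case: z01 => ->; rewrite lexx ler01.
Qed.

(** The right end is the endpoint following [p]; the open interval between them lies in [0,1], so it
    meets K. *)
Lemma ex_net_interval (a p q : R) : endpoints S a p -> endpoints S a q ->
  p < q -> exists2 b, b <= q & net_interval S `[0, 1] a p b.
Proof.
move=> ap aq pq.
have a0 : 0 < a by have [u [z [/Lambda_gt0]]] := endpointsE ap.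
have [b [ab pb bq bP]] := finite_next (finite_endpoints a0) aq pq.
exists b => //; split=> //; exists ((p + b) / 2).
have /andP[p0 _] := endpoints_unit ap; have /andP[_ b1] := endpoints_unit ab.
by split; rewrite /= in_itv /=; apply/andP; split; lra.
Qed.

Lemma simw_itv_sub w (x y : R) : x <= y ->
  (`[x, y]%classic `<=` simw w @` `[0, 1]) <->
  lo (simw w) <= x /\ y <= hi (simw w).
Proof.
move=> xy; split=> [sub|[lx yh] z].
  have /mem_simw_itv/andP[-> _] : (simw w @` `[0, 1]) x.
    by apply: sub; rewrite /= in_itv /= lexx.
  have /mem_simw_itv/andP[_ ->] // : (simw w @` `[0, 1]) y.
  by apply: sub; rewrite /= in_itv /= lexx xy.
rewrite /= in_itv /= => /andP[xz zy]; apply/mem_simw_itv.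
by rewrite (le_trans lx xz) (le_trans zy yh).
Qed.

Lemma overlap_net (a x y : R) u v : net_interval S `[0, 1] a x y ->
  lo (simw u) <= x -> y <= hi (simw u) ->
  lo (simw v) <= x -> y <= hi (simw v) -> 0 < overlap (simw u) (simw v).
Proof.
move=> [_ _ xy _ _] ? ? ? ?; rewrite subr_gt0 gt_max !lt_min.
by apply/andP; split; apply/andP; split; lra.
Qed.

Lemma neighbour_mapsP a u v : Lambda a u -> Lambda a v ->
  0 < overlap (simw u) (simw v) ->
  unit_neighbour_maps (pinv setT (simw u) \o simw v).
Proof.
move=> au av ov; exists a, u, v; split=> //; first exact: Lambda_gt0 au.
exact/overlap_gt0P.
Qed.

Definition neighbour_ends : set R :=
  [set f z | f in unit_neighbour_maps & z in [set 0; 1]].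

(** Let t cover the midpoint. No endpoint lies inside the net interval, so S_t([0,1]) contains it.
    An end of the net interval is an end of S_t([0,1]) or strictly inside it; in the latter case the
    interval S_w([0,1]) that it bounds overlaps S_t([0,1]). *)
Lemma net_interval_cover (a x y : R) : net_interval S `[0, 1] a x y ->
  exists t, [/\ Lambda a t, lo (simw t) <= x, y <= hi (simw t),
    neighbour_ends (pinv setT (simw t) x) & neighbour_ends (pinv setT (simw t) y)].
Proof.
move=> net; have [ax ay xy noend _] := net.
have [u [zu [au zu01 xu]]] := endpointsE ax.
have [v [zv [av zv01 yv]]] := endpointsE ay.
have /andP[x0 x1] := endpoints_unit ax; have /andP[y0 y1] := endpoints_unit ay.
have [||t at_ /andP[lm mh]] := @Lambda_cover _ _ _ K_unit a ((x + y) / 2).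
- by rewrite (Lambda_gt0 au) (Lambda_le1 au).
- by apply/andP; split; lra.
have [endl endh] := endpoints_lohi at_.
have lx : lo (simw t) <= x.
  by rewrite leNgt; apply/negP => xl; apply: (noend _ endl); rewrite xl /=; lra.
have yh : y <= hi (simw t).
  by rewrite leNgt; apply/negP => hy; apply: (noend _ endh); rewrite hy andbT; lra.
have key w z : Lambda a w -> [set 0; 1] z -> lo (simw t) < simw w z < hi (simw t) ->
    neighbour_ends (pinv setT (simw t) (simw w z)).
  move=> aw z01 /andP[tz zt]; exists (pinv setT (simw t) \o simw w); last by exists z.
  apply: (neighbour_mapsP at_ aw); rewrite subr_gt0 gt_max !lt_min !lo_lt_hi /=.
  have : lo (simw w) <= simw w z <= hi (simw w).
    rewrite (simw_itvE _ _ _).1; by case: z01 => ->; rewrite lexx ler01.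
  move=> /andP[wz zw]; rewrite andbT; apply/andP; split; lra.
have keyt z : [set 0; 1] z -> neighbour_ends (pinv setT (simw t) (simw t z)).
  move=> z01; exists (pinv setT (simw t) \o simw t); last by exists z.
  by apply: (neighbour_mapsP at_ at_); rewrite overlapxx ratiow_gt0.
have lohi_end : exists z1 z2, [/\ [set 0; 1] z1, [set 0; 1] z2,
    lo (simw t) = simw t z1 & hi (simw t) = simw t z2].
  have [s0 s1] : [set 0; 1] (0 : R) /\ [set 0; 1] (1 : R) by split; [left|right].
  by rewrite /lo /hi; case: (leP (simw t 0) (simw t 1)) => _;
    [exists 0, 1|exists 1, 0].
have [z1 [z2 [z101 z201 lE hE]]] := lohi_end.
exists t; split=> //.
  move: lx; rewrite le_eqVlt => /orP[/eqP <-|lx]; first by rewrite lE; exact: keyt.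
  by rewrite xu; apply: key; rewrite // -xu lx (lt_le_trans xy).
move: yh; rewrite le_eqVlt => /orP[/eqP ->|yh]; first by rewrite hE; exact: keyt.
by rewrite yv; apply: key; rewrite // -yv yh (le_lt_trans lx xy).
Qed.

(** * The four conditions and the finiteness of the neighbour maps *)

Lemma finite_neighbour_ends : finite_set unit_neighbour_maps ->
  finite_set neighbour_ends.
Proof. by move=> fin; apply: finite_image2 => //; exact: finite_set2. Qed.

Lemma net_map_bij (x y : R) : x < y -> bijective (net_map x y).
Proof. by move=> xy; apply: affine_bij; rewrite subr_eq0 gt_eqF. Qed.

(** With S_t([0,1]) containing the net interval, T^-1 S_w = (S_t^-1 T)^-1 (S_t^-1 S_w). The first
    factor depends only on the two relative ends and the second is a neighbour map, so every
    neighbour set is a subset of the finite set [F]. *)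
Lemma finite_neighbour_of_maps : finite_set unit_neighbour_maps ->
  finite_neighbour S `[0, 1].
Proof.
move=> finE; have finP := finite_neighbour_ends finE.
pose F := [set pinv setT (net_map pq.1 pq.2) \o e |
  pq in neighbour_ends `*` neighbour_ends & e in unit_neighbour_maps].
have finF : finite_set F by apply: finite_image2 => //; exact: finite_setX.
apply: sub_finite_set (finite_subsets finF) => A [a [x [y [a0 net ->]]]] f.
have [t [at_ tx yt px py]] := net_interval_cover net.
have [_ _ xy _ _] := net.
move=> [w [aw /simw_itv_sub]] /(_ (ltW xy))[wx yw] <-.
exists (pinv setT (simw t) x, pinv setT (simw t) y); first by split.
exists (pinv setT (simw t) \o simw w).
  by apply: (neighbour_mapsP at_ aw); exact: overlap_net net _ _ _ _.
set p := pinv setT (simw t) x; set q := pinv setT (simw t) y.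
have [tp tq] : simw t p = x /\ simw t q = y by rewrite !(simwK S t).2.
have netE z : simw t (net_map p q z) = net_map x y z.
  rewrite /net_map /affine -tq -tp simwB simwE [simw t p]simwE; ring.
(* The difference is negative when r_t < 0; [net_map p q] is then decreasing. *)
have qp : q - p != 0.
  by rewrite subr_eq0; apply/eqP => e; move: xy; rewrite -tp -tq e ltxx.
have K2 : cancel (pinv setT (net_map p q)) (net_map p q) := (affineK p qp).2.
have [K3 K4] := pinv_bijK (net_map_bij xy).
apply/funext => z /=; apply: (can_inj K3); rewrite K4 -netE.
by rewrite (K2 _) (simwK S t).2.
Qed.

(** The common part of S_u([0,1]) and S_v([0,1]) contains a net interval starting at its left end.
    Both T^-1 S_u and T^-1 S_v belong to its neighbour set, and S_u^-1 S_v = (T^-1 S_u)^-1 (T^-1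
    S_v). *)
Lemma finite_maps_of_neighbour : finite_neighbour S `[0, 1] ->
  finite_set unit_neighbour_maps.
Proof.
set X := (X in finite_set X -> _) => finX; rewrite -/X in finX.
pose N := \bigcup_(A in X) A.
have finN : finite_set N.
  apply: bigcup_finite => // A [a [x [y [a0 _ ->]]]].
  apply: finite_image; apply: sub_finite_set (finite_Lambda S a0).
  by move=> w [].
have finNN := finite_image2 (fun g h : R -> R => pinv setT g \o h) finN finN.
apply: sub_finite_set finNN.
move=> _ [a [u [v [a0 au av /overlap_gt0P ov ->]]]].
have [[ul uh] [vl vh]] := (endpoints_lohi au, endpoints_lohi av).
pose p := Num.max (lo (simw u)) (lo (simw v)).
pose q := Num.min (hi (simw u)) (hi (simw v)).
have ap : endpoints S a p by rewrite /p; case: leP.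
have aq : endpoints S a q by rewrite /q; case: leP.
have pq : p < q by rewrite -subr_gt0.
have [b bq net] := ex_net_interval ap aq pq.
have [[pu pv] [qu qv]] : (lo (simw u) <= p /\ lo (simw v) <= p) /\
    (q <= hi (simw u) /\ q <= hi (simw v)).
  rewrite /p /q; move: (lo _) (lo _) (hi _) (hi _) => ? ? ? ?.
  by rewrite !le_max !ge_min !lexx !orbT.
have [_ _ pb _ _] := net.
have Nw w : Lambda a w -> lo (simw w) <= p -> q <= hi (simw w) ->
    N (pinv setT (net_map p b) \o simw w).
  move=> aw lw hw; exists (neighbour_set S a p b); first by exists a, p, b.
  exists w => //; split=> //; apply/simw_itv_sub; first exact: ltW.
  by split=> //; exact: le_trans hw.
exists (pinv setT (net_map p b) \o simw u); first exact: Nw.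
exists (pinv setT (net_map p b) \o simw v); first exact: Nw.
have [K1 K2] := pinv_bijK (net_map_bij pb).
have gbij : bijective (pinv setT (net_map p b) \o simw u).
  by apply: bij_comp; [exists (net_map p b)|exists (pinv setT (simw u))]; case: (simwK S u).
have [K3 K4] := pinv_bijK gbij.
apply/funext => z; rewrite /= -[RHS]K3 /=; congr (pinv _ _ (pinv _ _ _)).
by rewrite (simwK S u).2.
Qed.

(** Endpoints p < q are at least as far apart as the ends of the net interval starting at p. Its
    length is |r_t| >= d a times a positive distance between two elements of the finite set
    [neighbour_ends]. *)
Lemma separated_of_maps : finite_set unit_neighbour_maps -> separated_endpoints S.
Proof.
move=> finE; have finP := finite_neighbour_ends finE.
have [d /andP[d0 _] dP] := ratio_lbound S.
pose A := [set `|p - q| | p in neighbour_ends & q in neighbour_ends] `&` [set x | 0 < x].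
have [c /andP[c0 _] cP] : exists2 c, 0 < c <= 1 & forall x, A x -> c <= x.
  apply: finite_pos_lbound => [|x []//].
  by apply: finite_setIl; exact: finite_image2.
exists (c * d) => [|a a01 u v au av z w z01 w01]; first exact: mulr_gt0.
have gap p q : endpoints S a p -> endpoints S a q -> p < q -> c * d * a <= q - p.
  move=> ap aq pq; have [b bq net] := ex_net_interval ap aq pq.
  have [t [at_ _ _ tp tb]] := net_interval_cover net.
  have [_ _ pb _ _] := net.
  apply: le_trans (_ : b - p <= _); last by rewrite lerB.
  have bpE : b - p = `|ratiow t| * `|pinv setT (simw t) b - pinv setT (simw t) p|.
    by rewrite -normrM -simwB !(simwK S t).2 gtr0_norm // subr_gt0.
  have /andP[/ltW a0 _] := a01.
  rewrite bpE -mulrA mulrC ler_pM ?mulr_ge0 ?(Lambda_ge _ dP) ?(ltW c0) ?(ltW d0) //.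
  apply: cP; split; first by exists (pinv setT (simw t) b) => //; exists (pinv setT (simw t) p).
  by move: pb; rewrite -subr_gt0 bpE pmulr_rgt0 ?ratiow_gt0.
have [pE qE] := (endpoints_end au z01, endpoints_end av w01).
have [lt|lt|->] := ltgtP (simw u z) (simw v w); [right|right|by left].
  by rewrite distrC gtr0_norm ?subr_gt0 // gap.
by rewrite gtr0_norm ?subr_gt0 // gap.
Qed.

(** Words of one generation have ratios comparable up to [d], so every positive overlap is at least
    a fixed proportion and [finite_big_overlaps] applies to all neighbour maps. *)
Lemma maps_of_weak_separation : weak_separation S -> finite_set unit_neighbour_maps.
Proof.
move=> wsc; have [d d01 gap] := sim_gap K_unit.
have [c c01 cP] := overlap_lbound K_unit wsc d01 gap.
have /andP[d0 d1] := d01; have /andP[c0 c1] := c01.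
have cd01 : 0 < c * d <= 1 by rewrite mulr_gt0 //= mulr_ile1 // ltW.
apply: sub_finite_set (finite_big_overlaps K_unit wsc cd01).
move=> _ [a [u [v [a0 au av /overlap_gt0P ov ->]]]].
have cmp x y : Lambda a x -> Lambda a y -> d * `|ratiow x| <= `|ratiow y|.
  move=> ax ay; apply: le_trans (_ : d * a <= _).
    by rewrite ler_wpM2l // ltW // (Lambda_lt ax).
  by apply: Lambda_ge ay => [|i]; [exact: ltW|case: (gap i)].
exists u, v; split=> //.
  apply: le_trans (cmp _ _ av au); rewrite -mulrA ler_piMl // mulr_ge0 //.
  exact: ltW.
apply: le_trans (cP _ _ (cmp _ _ au av) (cmp _ _ av au) ov).
by rewrite ler_wpM2r // ler_piMr // ltW.
Qed.

(** Take x0 = 0. If S_w(S_u(0)) lies in the ball, S_w(0) and S_w(1) lie within 2a of its centre. A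
    half-open cell of length c a contains at most one value S_w(0) and one value S_w(1), and these
    two determine S_w, hence the point. *)
Lemma weak_separation_of_separated : separated_endpoints S -> weak_separation S.
Proof.
move=> [c c0 sep].
(* Enough cells of length c a to cover an interval of length 4a. *)
pose M := (Num.truncn (4 / c)).+1.
exists 0, (M * M)%N => a a0 u y.
set A := (X in (X #<= _)%card).
have /choice[W WP] : forall p, exists w, A p -> Lambda a w /\ simw w (simw u 0) = p.
  by move=> p; have [[_ [w aw <-]]|nA] := pselect (A p); [exists w|exists [::]].
pose idx e := Num.truncn ((e - (y - 2 * a)) / (c * a)).
have ca0 : 0 < c * a by exact: mulr_gt0.
have u01 : 0 <= simw u 0 <= 1 by rewrite simw_unit // lexx ler01.
have near p z : A p -> [set 0; 1] z -> `|simw (W p) z - y| <= 2 * a.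
  move=> Ap z01; have [aw wp] := WP p Ap; case: Ap => + _.
  rewrite closed_ballE // /closed_ball_ /= => yp.
  have zu : `|z - simw u 0| <= 1.
    by case/andP: u01 => u0 u1; rewrite ler_norml; case: z01 => ->; apply/andP; split; lra.
  rewrite (le_trans (ler_distD p _ _)) // mulrDl mul1r lerD //; last by rewrite distrC.
  rewrite -{2}wp simwB normrM (le_trans _ (ltW (Lambda_lt aw))) //.
  by rewrite ler_piMr.
have near0 p z : A p -> [set 0; 1] z -> 0 <= (simw (W p) z - (y - 2 * a)) / (c * a).
  move=> Ap z01; rewrite divr_ge0 ?(ltW ca0) //.
  by have := near p z Ap z01; rewrite ler_norml => /andP[? _]; lra.
have idx_lt p z : A p -> [set 0; 1] z -> (idx (simw (W p) z) < M)%N.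
  move=> Ap z01; rewrite /M ltnS le_truncn // ler_pdivrMr //.
  rewrite mulrA divfK ?gt_eqF //.
  by have := near p z Ap z01; rewrite ler_norml => /andP[_ ?]; lra.
have idx_inj p q z : A p -> A q -> [set 0; 1] z ->
    idx (simw (W p) z) = idx (simw (W q) z) -> simw (W p) z = simw (W q) z.
  move=> Ap Aq z01 e; have [[aw _] [aw' _]] := (WP p Ap, WP q Aq).
  have a01 : 0 < a <= 1 by rewrite a0 (Lambda_le1 aw).
  have [//|] := sep a a01 _ _ aw aw' z z z01 z01.
  have /andP[p1 p2] := truncn_itv (near0 p z Ap z01).
  have /andP[q1 q2] := truncn_itv (near0 q z Aq z01).
  rewrite -/(idx _) e in p1 p2; rewrite -/(idx _) in q1 q2.
  have close : `|(simw (W p) z - (y - 2 * a)) / (c * a) - (simw (W q) z - (y - 2 * a)) / (c * a)| < 1.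
    by move: p2 q2; rewrite -natr1 => p2 q2; rewrite ltr_norml; apply/andP; split; lra.
  move: close; rewrite -mulrBl normrM normfV (gtr0_norm ca0) ltr_pdivrMr // mul1r.
  rewrite (_ : _ - _ = simw (W p) z - simw (W q) z) => [lt|]; last by ring.
  by rewrite leNgt lt.
pose h p := (idx (simw (W p) 0) * M + idx (simw (W p) 1))%N.
have z0 : [set 0; 1] (0 : R) by left.
have z1 : [set 0; 1] (1 : R) by right.
have hinj : {in A &, injective h}.
  move=> p q /set_mem Ap /set_mem Aq e.
  have [lp lq] := (idx_lt p 1 Ap z1, idx_lt q 1 Aq z1).
  have e0 : idx (simw (W p) 0) = idx (simw (W q) 0).
    by have := congr1 (divn^~ M) e; rewrite /h !divnMDl // !divn_small // !addn0.
  have e1 : idx (simw (W p) 1) = idx (simw (W q) 1).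
    by have := congr1 (modn^~ M) e; rewrite /h !modnMDl !modn_small.
  have [[_ <-] [_ <-]] := (WP p Ap, WP q Aq).
  rewrite simw_convex [RHS]simw_convex.
  by rewrite (idx_inj p q 0 Ap Aq z0 e0) (idx_inj p q 1 Ap Aq z1 e1).
rewrite -(card_le_eql (inj_card_eq hinj)); apply: subset_card_le.
move=> _ [p Ap <-] /=; rewrite /h.
have [l0 l1] := (idx_lt p 0 Ap z0, idx_lt p 1 Ap z1).
apply: leq_trans (_ : (idx (simw (W p) 0)).+1 * M <= _)%N; last by rewrite leq_mul2r l0 orbT.
by rewrite mulSn addnC ltn_add2r.
Qed.

Lemma interior_convex_hull_unit : (convex_hull (`[0, 1]%classic : set R))° = `]0, 1[%classic.
Proof.
have convex01 (t p q : R) : 0 <= t -> t <= 1 -> 0 <= p <= 1 -> 0 <= q <= 1 ->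
    0 <= t * p + (1 - t) * q <= 1.
  by move=> t0 t1 /andP[p0 p1] /andP[q0 q1]; apply/andP; split; nra.
rewrite /convex_hull smallest_id ?interior_itv // => x y l.
by rewrite !inE /= !in_itv /= => x01 y01; exact: convex01.
Qed.

Lemma convex_gftE : convex_gft S `[0, 1] <-> finite_set unit_neighbour_maps.
Proof.
rewrite /convex_gft interior_convex_hull_unit; split=> [[]//|fin].
split=> //.
- by exists (1 / 2); rewrite /= in_itv /=; apply/andP; split; lra.
- rewrite /mkset /bounded_near; near=> M => x /=; rewrite in_itv /= => /andP[x0 x1].
  rewrite gtr0_norm //; apply: le_trans (ltW x1) _.
  by near: M; exact: nbhs_pinfty_ge.
- move=> i x /(mem_simw_oitv S [:: i]) /andP[lx xh].
  have [l0 h1] := lohi_unit K_unit [:: i].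
  by rewrite /= in_itv /= (le_lt_trans l0 lx) (lt_le_trans xh h1).
Unshelve. all: by end_near.
Qed.

End Equivalence.

Unset Implicit Arguments.

Theorem corollary4p6 (R : realType) (k : nat) (S : ifs R k) (K : set R)
    (K_self_similar : self_similar_set S K) (K_unit : K = `[0, 1]%classic) :
  [<-> weak_separation S;
       finite_neighbour S K;
       convex_gft S K;
       separated_endpoints S].
Proof.
rewrite K_unit in K_self_similar *; tfae.
- by move/(maps_of_weak_separation K_self_similar); exact: finite_neighbour_of_maps.
- by move/(finite_maps_of_neighbour K_self_similar)/(convex_gftE K_self_similar).
- by move/(convex_gftE K_self_similar); exact: separated_of_maps.
- exact: weak_separation_of_separated.
Qed.
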